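(* Let $(M,d)$ be a nonempty compact metric space, $\Phi$ a set-valued dynamical system on $M$, and $\mu$ an invariant measure for $\Phi$. Then $\mu(\mathrm{BC}(\Phi))=1$, where $\mathrm{BC}(\Phi)$ is the Birkhoff center of $\Phi$.
   Context: For nonempty closed sets $A,B$ put $d_H(A,B):=\sup_{a\in A}d(a,B)$; the Hausdorff distance is $\max\{d_H(A,B),d_H(B,A)\}$. A set-valued dynamical system (SVDS) on $M$ is a map $\Phi$ assigning to each $(t,x)\in\mathbb{R}_+\times M$ a nonempty closed set $\Phi_t(x)\subset M$ such that: (a) $\Phi_0(x)=\{x\}$ for all $x$; (b) $\Phi_t(\Phi_s(x))=\Phi_{t+s}(x)$ for all $x$ and $s,t\ge0$, where $\Phi_t(A)=\bigcup_{a\in A}\Phi_t(a)$; (c) for each $x$, $t\mapsto\Phi_t(x)$ is continuous for the Hausdorff distance; (d) for each $t$, $x\mapsto\Phi_t(x)$ is upper semicontinuous: for all $x_0\in M$, $\varepsilon>0$ there is $\delta>0$ with $d_H(\Phi_t(x),\Phi_t(x_0))<\varepsilon$ for all $x\in B(x_0,\delta)$. An entire solution of $\Phi$ is a function $\mathbf{z}:\mathbb{R}\to M$ with $\mathbf{z}(t)\in\Phi_{t-s}(\mathbf{z}(s))$ for all $s\le t$ in $\mathbb{R}$ (such functions are continuous). $S_\Phi$ is the set of entire solutions and $S_\Phi(x)=\{\mathbf{z}\in S_\Phi:\mathbf{z}(0)=x\}$. $\mathcal{C}(\mathbb{R},M)$ carries the topology of uniform convergence on compact sets; $\Theta_t(\mathbf{y})(s)=\mathbf{y}(t+s)$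 is the translation flow on it ($t\in\mathbb{R}$) and $\pi_0(\mathbf{y})=\mathbf{y}(0)$. A Borel probability measure $\mu$ on $M$ is an invariant measure for $\Phi$ if there is a $\Theta$-invariant Borel probability measure $\nu$ on $S_\Phi$ whose push-forward $\pi_0^*(\nu)=\nu\circ\pi_0^{-1}$ equals $\mu$. For $\mathbf{z}\in S_\Phi$ let $L(\mathbf{z})=\bigcap_{t\ge0}\overline{\mathbf{z}([t,\infty))}$, and $L(x)=\bigcup_{\mathbf{z}\in S_\Phi(x)}L(\mathbf{z})$. The set of recurrent points is $R_\Phi=\{x\in M: x\in L(x)\}$, and the Birkhoff center is $\mathrm{BC}(\Phi)=\overline{R_\Phi}$. *)

(* Defs.v *)
From HB Require Import structures.
From mathcomp Require Import all_boot all_order all_algebra.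
From mathcomp Require Import all_classical all_reals all_analysis.

Set Implicit Arguments.
Unset Strict Implicit.
Unset Printing Implicit Defensive.

Import Order.TTheory GRing.Theory Num.Theory.
Import numFieldNormedType.Exports.

Local Open Scope classical_set_scope.
Local Open Scope ring_scope.

(* A [measurableType] is a pointed type, so the Borel space of a topological
   space T is indexed by a witness t0 that T is nonempty; its sigma-algebra
   does not depend on t0. *)
Definition pointed_at (T : topologicalType) (t0 : T) : Type := T.

HB.instance Definition _ (T : topologicalType) (t0 : T) :=
  Topological.copy (pointed_at t0) T.
HB.instance Definition _ (T : topologicalType) (t0 : T) :=
  isPointed.Build (pointed_at t0) t0.

Notation borel t0 := (g_sigma_algebraType (@open (pointed_at t0))).

Section hausdorff_distance.
Context {R : realType} {M : metricType R}.

(* Distances are taken in \bar R so that no boundedness is presupposed. *)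
Definition dist_set (a : M) (B : set M) : \bar R :=
  ereal_inf [set (mdist a b)%:E | b in B].

Definition dH (A B : set M) : \bar R :=
  ereal_sup [set dist_set a B | a in A].

Definition hausdorff_dist (A B : set M) : \bar R :=
  Order.max (dH A B) (dH B A).

End hausdorff_distance.

(* Only the values Phi t x with 0 <= t are meaningful. *)
Record svds {R : realType} {M : metricType R} (Phi : R -> M -> set M) : Prop :=
  SVDS {
  svds_nonempty : forall (t : R) (x : M), 0 <= t -> Phi t x !=set0 ;
  svds_closed : forall (t : R) (x : M), 0 <= t -> closed (Phi t x) ;
  svds0 : forall x : M, Phi 0 x = [set x] ;
  svdsD : forall (s t : R) (x : M), 0 <= s -> 0 <= t ->
    \bigcup_(y in Phi s x) Phi t y = Phi (t + s) x ;
  svds_continuous : forall (x : M) (t : R), 0 <= t -> forall e : R, 0 < e ->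
    \forall s \near t, 0 <= s ->
      (hausdorff_dist (Phi s x) (Phi t x) < e%:E)%E ;
  svds_usc : forall t : R, 0 <= t -> forall (x0 : M) (e : R), 0 < e ->
    exists2 delta : R, 0 < delta & forall x : M, ball x0 delta x ->
      (dH (Phi t x) (Phi t x0) < e%:E)%E
}.

(* C(R, M) with the topology of uniform convergence on compact sets. *)
Definition cfun (R : realType) (M : metricType R) : Type := continuousType R M.

HB.instance Definition _ (R : realType) (M : metricType R) :=
  Uniform.copy (cfun M)
    (initial_topology
       ((fun y => y : R -> M) : continuousType R M ->
                                {family compact, R -> M})).

Section translation_flow.
Context {R : realType} {M : metricType R}.

Lemma continuous_addl (t : R) : continuous (fun s : R => t + s).
Proof. by move=> s; apply: cvgD; [exact: cvg_cst|exact: cvg_id]. Qed.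

Lemma translation_continuous (t : R) (y : cfun M) :
  continuous (fun s : R => y (t + s)).
Proof.
move=> s; apply: (@continuous_comp _ _ _ (fun s : R => t + s) y).
  exact: continuous_addl.
exact: cts_fun.
Qed.

Definition translation (t : R) (y : cfun M) : cfun M :=
  mkcts (@translation_continuous t y).

End translation_flow.

Section entire_solutions.
Context {R : realType} {M : metricType R} (Phi : R -> M -> set M).

Definition entire_solution : set (R -> M) :=
  [set z | forall s t : R, s <= t -> Phi (t - s) (z s) (z t)].

Definition entire_solution_at (x : M) : set (R -> M) :=
  [set z | entire_solution z /\ z 0 = x].

(* S_Phi as a topological subspace of C(R, M): for an SVDS on a compact space
   every entire solution is continuous, so no solution is lost. *)
Definition solution_space : set (cfun M) := [set y | entire_solution y].

Lemma translation_solution (t : R) (z : solution_space) :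
  translation t (set_val z) \in solution_space.
Proof.
have /set_mem Sz := valP z; apply/mem_set => s u su /=.
have := Sz (t + s) (t + u); rewrite lerD2l.
by rewrite opprD addrACA subrr add0r; exact.
Qed.

Definition solution_translation (t : R) (z : solution_space) : solution_space :=
  SigSub (translation_solution t z).

Definition solution_eval0 (z : solution_space) : M := set_val z 0.

Definition invariant_measure (x0 : M) (mu : probability (borel x0) R) : Prop :=
  exists (z0 : solution_space) (nu : probability (borel z0) R),
    (forall (t : R) (A : set (borel z0)), measurable A ->
       pushforward nu (solution_translation t : borel z0 -> borel z0) A = nu A)
    /\
    (forall A : set (borel x0), measurable A ->
       mu A = pushforward nu (solution_eval0 : borel z0 -> borel x0) A).

Definition limit_set (z : R -> M) : set M :=
  \bigcap_(t in [set t : R | 0 <= t]) closure (z @` `[t, +oo[).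

Definition point_limit_set (x : M) : set M :=
  \bigcup_(z in entire_solution_at x) limit_set z.

Definition recurrent : set M := [set x | point_limit_set x x].

Definition birkhoff_center : set M := closure recurrent.

End entire_solutions.

(* Main.v *)
Require Import Defs.
From HB Require Import structures.
From mathcomp Require Import all_boot all_order all_algebra.
From mathcomp Require Import all_classical all_reals all_analysis.

(** Let nu be a translation-invariant probability on the space of entire
    solutions whose image under evaluation at time 0 is mu.  The claim is
    Poincare recurrence for nu: almost every solution z comes back, at
    arbitrarily large times, arbitrarily close to z 0, and this says that z 0
    lies in the limit set of z itself, hence is a recurrent point.

    Quantitatively, let U be open in M and k a natural number.  The solutions
    that start in U but avoid U at all the times k, 2k, 3k, ... form a null set
    ([poincare_recurrence] applied to the translation by k); the sets involved
    are measurable because evaluation at a fixed time is continuous on the space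
    of solutions ([solution_eval_continuous]).  Compactness provides a countable
    basis of M ([compact_countable_basis]), so discarding countably many null
    sets handles all basic open sets U and all k simultaneously.  A remaining
    solution returns to every basic neighbourhood of z 0 at arbitrarily large
    times, hence starts at a recurrent point ([recurrent_of_returns]). *)

Set Implicit Arguments.
Unset Strict Implicit.
Unset Printing Implicit Defensive.

Import Order.TTheory GRing.Theory Num.Theory.
Import numFieldNormedType.Exports.

Local Open Scope classical_set_scope.
Local Open Scope ring_scope.

Section poincare.
Context d (T : measurableType d) (R : realType) (P : probability T R).

(** Infinitely many disjoint sets of the same positive measure would
    eventually exceed the total mass 1. *)
Lemma equimeasurable_disjoint_null (F : nat -> set T) :
  (forall n, measurable (F n)) -> trivIset setT F ->
  (forall n, P (F n) = P (F 0%N)) -> P (F 0%N) = 0%E.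
Proof.
move=> mF tF eF; apply/eqP; rewrite -measure_le0 leNgt; apply/negP => P0.
have Pfin : P (F 0%N) \is a fin_num by exact: fin_num_measure.
have p0 : 0 < fine (P (F 0%N)) by rewrite fine_gt0// P0 ltey_eq Pfin.
pose N := (Num.truncn (fine (P (F 0%N)))^-1).+1.
have N_large : (fine (P (F 0%N)))^-1 < N%:R by exact: Num.Theory.truncnS_gt.
have : (\sum_(0 <= i < N) P (F i) <= 1)%E.
  rewrite big_mkord -measure_bigsetU//.
  by apply: probability_le1; exact: bigsetU_measurable.
under eq_bigr do rewrite eF -(fineK Pfin).
rewrite sumEFin lee_fin sumr_const_nat subn0 leNgt => /negP; apply.
by rewrite -mulr_natr -ltr_pdivrMl// mulr1.
Qed.

(** The set W of points of A that never return to A is wandering: its preimages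
    under the iterates of f are pairwise disjoint, since a point of
    f^-m(W) and f^-n(W) with m < n would have its m-th image in W, yet return to
    A after n - m steps.  These preimages all have the measure of W.
    Measurability is stated for the iterated preimages of A because, for a
    translation of solutions and A given by an open condition at time 0, it is
    immediate from the continuity of evaluation at a later time. *)
Lemma poincare_recurrence (f : T -> T) (A : set T) :
  (forall B, measurable B -> P (f @^-1` B) = P B) ->
  (forall n, measurable (iter n f @^-1` A)) ->
  P.-negligible (A `&` \bigcap_n (iter n.+1 f @^-1` (~` A))).
Proof.
move=> Pf mA; set W := (X in P.-negligible X).
have mF n : measurable (iter n f @^-1` W).
  have -> : iter n f @^-1` W = iter n f @^-1` A `&`
      \bigcap_i ~` (iter (i.+1 + n) f @^-1` A).
    by apply/seteqP; split=> x [Ax nAx]; split=> // i _; have := nAx i I;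
      rewrite /preimage /setC /mkset iterD.
  apply: measurableI => //; apply: bigcapT_measurable => i.
  exact: measurableC.
exists W; split=> //; first exact: (mF 0%N).
apply: (@equimeasurable_disjoint_null (fun n => iter n f @^-1` W)) => //.
- apply: ltn_trivIset => n m mn.
  apply/seteqP; split=> // x [[_ Wm] [An _]].
  apply: (Wm (n - m).-1 I).
  by rewrite /preimage /mkset -iterD prednK ?subn_gt0// subnK// ltnW.
- elim=> // n IH; rewrite -IH -(Pf _ (mF n)); congr (P _).
  by apply/funext => x; rewrite /preimage /mkset iterSr.
Qed.

End poincare.

Section solutions.
Context {R : realType} {M : metricType R} (Phi : R -> M -> set M).

(** A singleton of times is compact, so uniform convergence on compact sets
    implies convergence at each time. *)
Lemma solution_eval_continuous (t : R) :
  continuous (fun z : solution_space Phi => set_val z t).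
Proof.
have eval_family (y : {family compact, R -> M}) :
    g t @[g --> nbhs y] --> y t.
  have /fam_cvgP /(_ [set t] (@compact_set1 _ t)) :
    {family compact, nbhs y --> y} by exact: cvg_id.
  by rewrite uniform_set1.
pose graph (y : cfun M) : {family compact, R -> M} := y : R -> M.
have graph_cont : continuous graph by exact: initial_continuous.
have sol_cont : continuous (@set_val _ (solution_space Phi)).
  exact: initial_continuous.
move=> z; apply: (@continuous_comp _ _ _ (@set_val _ (solution_space Phi))
  (fun y : cfun M => y t)); first exact: sol_cont.
apply: (@continuous_comp _ _ _ graph (fun y => y t)); first exact: graph_cont.
exact: eval_family.
Qed.

Lemma iter_solution_translation (t s : R) n (z : solution_space Phi) :
  set_val (iter n (solution_translation t) z) s = set_val z (n%:R * t + s).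
Proof.
elim: n s => [|n IH] s; first by rewrite mul0r add0r.
rewrite iterS -[LHS]/(set_val (iter n (solution_translation t) z) (t + s)).
by rewrite IH -natr1 mulrDl mul1r addrA.
Qed.

(** Only basic open sets and integer lower bounds on the return times are
    tested, which is a countable family of conditions. *)
Lemma recurrent_of_returns (B : set (set M)) (z : R -> M) :
  basis B -> entire_solution Phi z ->
  (forall U, B U -> U (z 0) -> forall k, exists2 t, k%:R <= t & U (z t)) ->
  recurrent Phi (z 0).
Proof.
move=> [_ Bnbhs] Sz ret; exists z => // t /= t0 U Uz.
have [V [BV Vz0] VU] := Bnbhs _ _ Uz.
have [s ks Vzs] := ret V BV Vz0 (Num.truncn t).+1.
exists (z s); split; last exact: VU.
exists s => //=.
by rewrite in_itv/= andbT (le_trans _ ks)// ltW// Num.Theory.truncnS_gt.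
Qed.

End solutions.

HB.instance Definition _ (R : realType) (T : pseudoMetricType R) (t0 : T) :=
  PseudoMetric.copy (pointed_at t0) T.

(** An indexing by nat, rather than a countable set, fits countable unions of
    null sets. *)
Lemma compact_countable_basis (R : realType) (M : metricType R) (x0 : M) :
  compact [set: M] ->
  exists U : nat -> set M, (forall i, open (U i)) /\ basis (range U).
Proof.
move=> /(@compact_second_countable R (pointed_at x0)).
move=> [B /pcard_surjP [f Bf] [Bopen Bnbhs]].
(* The enumeration f covers B but may take values outside B; interiors make
   every value open and leave the members of B unchanged. *)
exists (fun i => (f i)°); split=> [i|]; first exact: open_interior.
split=> [_ [i _ <-]|x V Vx]; first exact: open_interior.
have [U [BU Ux] UV] := Bnbhs x V Vx.
exists U => //; split=> //.
have [i _ fiU] := Bf U BU.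
by exists i => //; rewrite fiU; apply/interior_id/Bopen.
Qed.

Theorem theorem2p10 (R : realType) (M : metricType R) (x0 : M)
    (hM : compact [set: M]) (Phi : R -> M -> set M) (hPhi : svds Phi)
    (mu : probability (borel x0) R) (hmu : invariant_measure Phi mu) :
  mu (birkhoff_center Phi) = 1%E.
Proof.
have [z0 [nu [nu_inv mu_nu]]] := hmu.
have [U [U_open U_basis]] := compact_countable_basis x0 hM.
have center_open : open (~` birkhoff_center Phi).
  by apply: closed_openC; exact: closed_closure.
have m_center : measurable (birkhoff_center Phi : set (borel x0)).
  rewrite -(setCK (birkhoff_center Phi)); apply: measurableC.
  exact: sub_sigma_algebra.
have m_eval t (V : set M) : open V ->
    measurable ((fun z : borel z0 => set_val z t) @^-1` V).
  move=> oV; apply: sub_sigma_algebra.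
  by move/continuousP: (@solution_eval_continuous _ _ Phi t); exact.
pose ev : borel z0 -> M := @solution_eval0 _ _ Phi.
pose shift (k : nat) : borel z0 -> borel z0 := solution_translation k%:R.
have shiftE k n (z : borel z0) :
    ev (iter n (shift k) z) = set_val z (n%:R * k%:R).
  by rewrite /ev /solution_eval0 iter_solution_translation addr0.
have m_ev_center : measurable (ev @^-1` birkhoff_center Phi).
  rewrite -(setCK (birkhoff_center Phi)) -preimage_setC; apply: measurableC.
  exact: (m_eval 0 (~` _)).
pose W i k := (ev @^-1` U i) `&`
  \bigcap_n (iter n.+1 (shift k) @^-1` (~` (ev @^-1` U i))).
have W_null i k : nu.-negligible (W i k).
  have m_iter n : measurable (iter n (shift k) @^-1` (ev @^-1` U i)).
    rewrite (_ : _ @^-1` _ =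
      (fun z : borel z0 => set_val z (n%:R * k%:R)) @^-1` U i).
      exact: m_eval.
    by apply/funext => z; rewrite /preimage /mkset shiftE.
  exact: (poincare_recurrence (nu_inv k%:R) m_iter).
have null : nu (~` (ev @^-1` birkhoff_center Phi)) = 0%E.
  apply: measure_negligible; first exact: measurableC.
  apply: negligibleS (negligible_bigcup (fun i => negligible_bigcup (W_null i))).
  move=> z; apply: contra_notP => nW; apply: subset_closure.
  apply: (recurrent_of_returns U_basis); first exact: (set_valP z).
  move=> _ [i _ <-] Uz k.
  apply: contra_notP nW => noret.
  exists i => //; exists k => //; split=> // n _ /= Uzn.
  apply: noret; exists (n.+1%:R * k%:R); last by rewrite -shiftE.
  by rewrite -natrM ler_nat leq_pmull.
rewrite mu_nu// -[LHS]/(nu (ev @^-1` birkhoff_center Phi)).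
rewrite -[X in nu X]setCK.
by rewrite probability_setC ?null ?sube0//; exact: measurableC.
Qed.
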